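(* Let $S=\langle V,E\rangle$ be a strongly connected Büchi bidding game with set of accepting vertices $F\subseteq V$. If $S$ contains a cycle $C$ that does not traverse any vertex in $F$, then for every $k\in\mathbb{N}$, every initial vertex, and every positive initial budget of Player 2, Player 2 has a strategy that forces the token to traverse the cycle $C$ $k$ times without visiting a vertex of $F$ in between. In particular, no accepting vertex is visited for at least $k$ consecutive rounds.
   Context: A bidding game is played on a finite directed graph $(V,E)$ by moving a token. Player 1 and Player 2 hold budgets $B_1,B_2\ge0$ with $B_1+B_2=1$. In each round both players simultaneously submit a bid, a real number in $[0,B_i]$; the higher bidder pays his bid to the other player and moves the token along an outgoing edge of the current vertex; ties are resolved by some fixed tie-breaking rule. A strategy maps each finite history (visited vertices together with winning bids and winners) to a legal bid and a successor vertex to move to upon winning. In a Büchi bidding game with accepting set $F$, Player 1 wins an infinite play iff it visits $F$ infinitely often. *)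

(* Defs.v *)
From HB Require Import structures.
From mathcomp Require Import all_boot all_order all_algebra.
From mathcomp Require Import reals.

Set Implicit Arguments.
Unset Strict Implicit.
Unset Printing Implicit Defensive.

Import Order.TTheory GRing.Theory Num.Theory.
Local Open Scope ring_scope.

Definition strongly_connected (V : finType) (E : rel V) : Prop :=
  forall u v : V, connect E u v.

Inductive player := player1 | player2.

(* [Step h i b v] extends [h] by a round that player [i] won with the winning *)
(* bid [b], after which [i] moved the token to [v].                           *)
Inductive history (R : realType) (V : finType) : Type :=
| Start of V
| Step of history R V & player & R & V.

Definition current (R : realType) (V : finType) (h : history R V) : V :=
  match h with
  | Start v => v
  | Step _ _ _ v => v
  end.

(* The winner pays the winning bid to the other player. *)
Fixpoint budget (R : realType) (V : finType) (B : player -> R)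
    (h : history R V) (i : player) : R :=
  match h with
  | Start _ => B i
  | Step h' w b _ =>
      match w, i with
      | player1, player1 | player2, player2 => budget B h' i - b
      | player1, player2 | player2, player1 => budget B h' i + b
      end
  end.

Fixpoint valid_history (R : realType) (V : finType) (E : rel V)
    (B : player -> R) (h : history R V) : Prop :=
  match h with
  | Start _ => True
  | Step h' i b v =>
      [/\ valid_history E B h', 0 <= b <= budget B h' i & E (current h') v]
  end.

Definition strategy (R : realType) (V : finType) : Type :=
  history R V -> R * V.

(* Legality is only required on valid histories: on an arbitrary history the  *)
(* computed budget may be negative, and then no bid at all would be legal.    *)
Definition legal_strategy (R : realType) (V : finType) (E : rel V)
    (B : player -> R) (i : player) (s : strategy R V) : Prop :=
  forall h : history R V, valid_history E B h ->
    0 <= (s h).1 <= budget B h i /\ E (current h) (s h).2.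

(* The winner of a tie may depend on the history and on the common bid. *)
Definition tie_breaking (R : realType) (V : finType) : Type :=
  history R V -> R -> player.

Definition round_winner (R : realType) (V : finType) (tie : tie_breaking R V)
    (h : history R V) (b1 b2 : R) : player :=
  if b2 < b1 then player1 else if b1 < b2 then player2 else tie h b1.

Definition next_round (R : realType) (V : finType) (tie : tie_breaking R V)
    (s1 s2 : strategy R V) (h : history R V) : history R V :=
  match round_winner tie h (s1 h).1 (s2 h).1 with
  | player1 => Step h player1 (s1 h).1 (s1 h).2
  | player2 => Step h player2 (s2 h).1 (s2 h).2
  end.

Definition play (R : realType) (V : finType) (tie : tie_breaking R V)
    (s1 s2 : strategy R V) (v0 : V) (n : nat) : V :=
  current (iter n (next_round tie s1 s2) (Start R v0)).

(* From time [n] on, the token goes [k] times in a row around the closed walk *)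
(* listed by [c], from its first vertex back to it; the default value of      *)
(* [nth] is irrelevant for nonempty [c].                                      *)
Definition traverses (V : finType) (c : seq V) (k : nat) (pi : nat -> V)
    (n : nat) : Prop :=
  forall j : nat, (j <= k * size c)%N ->
    pi (n + j)%N = nth (pi n) c (j %% size c).

(* The [m] rounds starting at time [n] visit the vertices pi n, ..., pi (n+m) *)
Definition avoids_for (V : finType) (F : {set V}) (m : nat) (pi : nat -> V)
    (n : nat) : Prop :=
  forall j : nat, (j <= m)%N -> pi (n + j)%N \notin F.

(* Main.v *)
Require Import Defs.
From HB Require Import structures.
From mathcomp Require Import all_boot all_order all_algebra.
From mathcomp Require Import reals.
From mathcomp Require Import boolp ring lra.

Set Implicit Arguments.
Unset Strict Implicit.
Unset Printing Implicit Defensive.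

Import Order.TTheory GRing.Theory Num.Theory.
Local Open Scope ring_scope.

(* Player 2 repeatedly attempts to win N rounds in a row, following a walk that
   leads to c and then goes around it k times.  After t consecutive wins he bids
   delta (2^(t+1) - 1), so that a lost round repays more than the whole attempt
   cost: the quantity budget + delta (2^(t+1) - 2) grows by at least delta in
   every round.  Since it is bounded while t < N, some attempt succeeds. *)

Section Histories.
Variables (R : realType) (V : finType) (E : rel V) (B : player -> R).
Implicit Types (h : history R V) (s : strategy R V) (tie : tie_breaking R V).

Lemma budget_total h :
  budget B h player1 + budget B h player2 = B player1 + B player2.
Proof. by elim: h => [//|h <- [] b v] /=; ring. Qed.

Lemma budget_ge0 h i : (forall j, 0 <= B j) -> valid_history E B h ->
  0 <= budget B h i.
Proof.
move=> B_ge0; elim: h i => [//|h IH w b v] i /= [/IH h_ge0 /andP[b_ge0 b_le] _].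
case: w i b_le => -[] b_le; by rewrite ?subr_ge0 ?addr_ge0.
Qed.

Lemma next_round_valid tie s1 s2 h :
  legal_strategy E B player1 s1 -> legal_strategy E B player2 s2 ->
  valid_history E B h -> valid_history E B (next_round tie s1 s2 h).
Proof.
move=> legal1 legal2 hv; rewrite /next_round.
by case: (round_winner _ _ _ _) => /=; [case: (legal1 h hv) | case: (legal2 h hv)].
Qed.

Lemma iter_next_round_valid tie s1 s2 v0 n :
  legal_strategy E B player1 s1 -> legal_strategy E B player2 s2 ->
  valid_history E B (iter n (next_round tie s1 s2) (Start R v0)).
Proof. by move=> legal1 legal2; elim: n => //= n; exact: next_round_valid. Qed.

(** A tie may go to Player 1, hence the weak inequality; it still bounds from below what Player 2
    receives on a loss. *)
Lemma next_round_cases tie s1 s2 h :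
  next_round tie s1 s2 h = Step h player2 (s2 h).1 (s2 h).2 \/
  next_round tie s1 s2 h = Step h player1 (s1 h).1 (s1 h).2 /\
    (s2 h).1 <= (s1 h).1.
Proof.
rewrite /next_round /round_winner; case: ltrgtP => [lt21|lt12|eq12].
- by right; split=> //; exact: ltW.
- by left.
- by case: (tie _ _); [right | left].
Qed.

Fixpoint streak h : nat :=
  if h is Step h' player2 _ _ then (streak h').+1 else 0.

(** The vertex where the current streak began; it selects the walk that the present attempt
    follows. *)
Fixpoint anchor h : V :=
  match h with
  | Start v => v
  | Step h' player2 _ _ => anchor h'
  | Step _ player1 _ v => v
  end.

End Histories.

Section Pressing.
Variables (R : realType) (V : finType) (E : rel V) (B : player -> R).
Variables (w : V -> nat -> V) (delta : R).
Hypothesis B_ge0 : forall i, 0 <= B i.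
Hypothesis w0 : forall u, w u 0 = u.
Hypothesis wE : forall u i, E (w u i) (w u i.+1).
Hypothesis delta_gt0 : 0 < delta.

(* Until a streak of the desired length is reached, a play against this strategy
   never triggers the minimum or the test: they only ensure legality elsewhere. *)
Definition pressing_strategy : strategy R V := fun h =>
  (Num.min (delta * (2 ^+ (streak h).+1 - 1)) (budget B h player2),
   let v := w (anchor h) (streak h).+1 in
   if E (current h) v then v else w (current h) 1).

Lemma pressing_strategy_legal : legal_strategy E B player2 pressing_strategy.
Proof.
move=> h hv; split.
  rewrite /= ge_min lexx orbT andbT le_min (budget_ge0 _ B_ge0 hv) andbT.
  by rewrite mulr_ge0 ?ltW // subr_gt0 exprn_egt1 // ltr1n.
rewrite /=; case: ifP => // _.
by have := wE (current h) 0; rewrite w0.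
Qed.

Variables (tie : tie_breaking R V) (s1 : strategy R V) (v0 : V).
Hypothesis s1_legal : legal_strategy E B player1 s1.

Let H n := iter n (next_round tie s1 pressing_strategy) (Start R v0).

Let H_valid n : valid_history E B (H n).
Proof. exact: iter_next_round_valid s1_legal pressing_strategy_legal. Qed.

(** Here [n] is the time at which the current streak began. The token stands on the walk at index
    [streak], so by [wE] the edge test succeeds and a win advances along the walk; a loss starts a
    new walk at the vertex chosen by Player 1. *)
Lemma pressing_follows_walk m : exists2 n, m = (n + streak (H m))%N &
  forall j, (j <= streak (H m))%N -> current (H (n + j)) = w (anchor (H m)) j.
Proof.
elim: m => [|m [n def_m walk]].
  by exists 0 => // j; rewrite leqn0 => /eqP ->; rewrite w0.
have [eqH|[eqH _]] := next_round_cases tie s1 pressing_strategy (H m).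
  have eqH' : H m.+1 = _ := eqH; rewrite eqH' /=.
  exists n => [|j]; first by rewrite addnS -def_m.
  rewrite leq_eqVlt ltnS => /orP[/eqP->|/walk //].
  have cur := walk _ (leqnn _); rewrite -def_m in cur.
  by rewrite addnS -def_m eqH' /= cur wE.
have eqH' : H m.+1 = _ := eqH; rewrite eqH' /=.
exists m.+1 => [|j]; first by rewrite addn0.
by rewrite leqn0 => /eqP->; rewrite addn0 eqH' w0.
Qed.

Variable N : nat.
Hypothesis deltaN : delta * 2 ^+ N.+1 <= B player2.

(** At streak [t], a win costs [delta * (2 ^+ t.+1 - 1)] and raises the second term by
    [delta * 2 ^+ t.+1]; a loss earns at least that bid and erases [delta * (2 ^+ t.+1 - 2)]. Both
    gain at least [delta]. *)
Lemma pressing_potential m : (forall n, (streak (H n) < N)%N) ->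
  B player2 + delta * m%:R <=
    budget B (H m) player2 + delta * (2 ^+ (streak (H m)).+1 - 2).
Proof.
move=> ltN; elim: m => [|m IH].
  by rewrite /= expr1 subrr mulr0.
(* The intended bid is affordable: by [IH] it suffices that [delta * (2 ^+ t.+2 - 3) <= B player2],
   which follows from [t < N] and [deltaN]. *)
have bidE : (pressing_strategy (H m)).1 = delta * (2 ^+ (streak (H m)).+1 - 1).
  apply/min_idPl.
  have : delta * 2 ^+ (streak (H m)).+2 <= delta * 2 ^+ N.+1.
    by rewrite ler_pM2l // ler_eXn2l ?ltr1n // ltnS ltN.
  have m_ge0 : 0 <= delta * m%:R by rewrite mulr_ge0 // ltW.
  move: IH deltaN delta_gt0; rewrite (exprS _ _.+1).
  by move: (2 ^+ _ : R) (2 ^+ _ : R) => X Y *; lra.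
have [eqH|[eqH]] := next_round_cases tie s1 pressing_strategy (H m).
  rewrite bidE in eqH; have eqH' : H m.+1 = _ := eqH; rewrite eqH' /= -natr1.
  by move: IH; rewrite (exprS _ _.+1); move: (2 ^+ _ : R) => X *; lra.
rewrite bidE => le_bid; have eqH' : H m.+1 = _ := eqH; rewrite eqH' /= -natr1.
by move: IH le_bid; rewrite expr1; move: (2 ^+ _ : R) => X *; lra.
Qed.

Lemma pressing_streak : exists m, streak (H m) = N.
Proof.
apply: contrapT => noN.
(* A streak starts at 0 and grows by at most one per round, so it cannot exceed [N] without first
   equalling it. *)
have ltN n : (streak (H n) < N)%N.
  have neN i : streak (H i) != N by apply/eqP => eqN; case: noN; exists i.
  elim: n => [|n IH]; first by have := neN 0; rewrite lt0n eq_sym.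
  rewrite ltn_neqAle neN andTb.
  have [eqH|[eqH _]] := next_round_cases tie s1 pressing_strategy (H n);
    by have eqH' : H n.+1 = _ := eqH; rewrite eqH'.
(* The potential never exceeds the total money plus [B player2], so [delta * m%:R] cannot exceed the
   total money. *)
have [m] : exists m : nat, B player1 + B player2 < delta * m%:R.
  exists (Num.truncn ((B player1 + B player2) / delta)).+1.
  by rewrite mulrC -ltr_pdivrMr // truncnS_gt.
have := pressing_potential m ltN; have := budget_total B (H m).
have := budget_ge0 player1 B_ge0 (H_valid m).
have : delta * 2 ^+ (streak (H m)).+1 <= delta * 2 ^+ N.+1.
  by rewrite ler_pM2l // ler_eXn2l ?ltr1n // ltnS ltnW.
move: deltaN delta_gt0.
by move: (2 ^+ _ : R) (2 ^+ _ : R) => X Y *; lra.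
Qed.

End Pressing.

(** Follow a path from [u] to the head of [c], then circle forever; [wl.2] is the length of that
    path. *)
Lemma walk_to_cycle (V : finType) (E : rel V) (c : seq V) (u : V) :
  strongly_connected E -> c <> [::] -> cycle E c ->
  exists wl : (nat -> V) * nat,
    [/\ wl.1 0 = u, forall i, E (wl.1 i) (wl.1 i.+1)
      & forall j, wl.1 (wl.2 + j)%N = nth u c (j %% size c)].
Proof.
move=> hE; case: c => // x c _ hc; have /connectP[p hp def_x] := hE u x.
pose f i := if (i < size p)%N then nth u (u :: p) i
            else nth u (x :: c) ((i - size p) %% (size c).+1).
(* The path ends at the head of the cycle, so the two branches of [f] agree at the junction, even
   for empty [p]. *)
have f_last i : i = size p -> f i = nth u (u :: p) i.
  by move=> ->; rewrite /f ltnn subnn mod0n /= def_x (last_nth u).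
exists (f, size p); split=> [|i|j] /=.
- by have [/esym/f_last->|p_gt0] := posnP (size p); rewrite // /f p_gt0.
- have [lt_i|le_i] := ltnP i (size p).
    have -> : f i.+1 = nth u (u :: p) i.+1.
      move: lt_i; rewrite leq_eqVlt => /orP[/eqP/f_last //|lt_i].
      by rewrite /f lt_i.
    by rewrite /f lt_i; exact: (elimT (pathP u) hp).
  rewrite /f !ltnNge le_i (leqW le_i) /= subSn //.
  move: (i - size p)%N => {le_i}i.
  have lt_m : (i %% (size c).+1 < (size c).+1)%N by rewrite ltn_pmod.
  (* [cycle] is a path along [rcons c x]: its last edge, at index [size c], returns to [x], just
     where the successor wraps to 0. *)
  have := elimT (pathP u) hc (i %% (size c).+1)%N.
  rewrite size_rcons => /(_ lt_m).
  rewrite -rcons_cons nth_rcons lt_m /= nth_rcons.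
  have -> : (i.+1 %% (size c).+1 = (i %% (size c).+1).+1 %% (size c).+1)%N.
    by rewrite -addn1 -modnDml addn1.
  rewrite ltnS in lt_m; case: ltngtP lt_m => //.
    by move=> lt_c _; rewrite [(_.+1 %% _)%N]modn_small ?ltnS.
  by move=> -> _; rewrite modnn.
- by rewrite /f ltnNge leq_addr addKn.
Qed.

Theorem theorem12 (R : realType) (V : finType) (E : rel V) (F : {set V})
    (hE : strongly_connected E)
    (c : seq V) (hc0 : c <> [::]) (hc : cycle E c)
    (hcF : forall v : V, v \in c -> v \notin F)
    (tie : tie_breaking R V) (k : nat) (v0 : V)
    (B : player -> R) (hB1 : 0 <= B player1) (hB2 : 0 < B player2)
    (hB : B player1 + B player2 = 1) :
  exists s2 : strategy R V, legal_strategy E B player2 s2 /\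
    forall s1 : strategy R V, legal_strategy E B player1 s1 ->
      exists n : nat,
        [/\ traverses c k (play tie s1 s2 v0) n,
            avoids_for F (k * size c) (play tie s1 s2 v0) n
          & avoids_for F k (play tie s1 s2 v0) n].
Proof.
have c_gt0 : (0 < size c)%N by case: (c) hc0.
have [wl wlP] := fin_all_exists (fun u => walk_to_cycle u hE hc0 hc).
pose w u := (wl u).1; pose l u := (wl u).2.
have w0 u : w u 0 = u by case: (wlP u).
have wE u i : E (w u i) (w u i.+1) by have [_ /(_ i)] := wlP u.
have wc u j : w u (l u + j)%N = nth u c (j %% size c).
  by have [_ _ /(_ j)] := wlP u.
(* The anchor of the successful streak depends on [s1], so [N] allows for the longest approach,
   followed by [k] laps. *)
pose N := (\max_u l u + k * size c)%N.
pose delta : R := B player2 / 2 ^+ N.+1.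
have delta_gt0 : 0 < delta by rewrite divr_gt0 ?exprn_gt0.
have deltaN : delta * 2 ^+ N.+1 <= B player2 by rewrite divfK ?lt0r_neq0 ?exprn_gt0.
have B_ge0 i : 0 <= B i by case: i; rewrite // ltW.
exists (pressing_strategy E B w delta); split.
  exact: pressing_strategy_legal.
move=> s1 s1_legal.
have [m defN] := pressing_streak B_ge0 w0 wE delta_gt0 tie v0 s1_legal deltaN.
have [n _] := pressing_follows_walk B delta w0 wE tie s1 v0 m.
rewrite defN; set u := anchor _ => walk.
set pi := play _ _ _ _.
have tour j : (j <= k * size c)%N -> pi (n + l u + j)%N = nth u c (j %% size c).
  move=> le_j; rewrite -wc -addnA; apply: walk.
  by apply: leq_add => //; exact: leq_bigmax.
have trav : traverses c k pi (n + l u).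
  (* The default values [u] and [pi (n + l u)] differ, but the index is below [size c]. *)
  by move=> j /tour ->; apply: set_nth_default; rewrite ltn_mod.
have avoid : avoids_for F (k * size c) pi (n + l u).
  by move=> j /tour ->; apply: hcF; rewrite mem_nth ?ltn_mod.
exists (n + l u)%N; split=> // j le_j.
by apply: avoid; rewrite (leq_trans le_j) ?leq_pmulr.
Qed.
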